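(* Let $A$ be the function on the positive integers, with values in $\mathbb{N}$, $n\mapsto A_n$, defined recursively by $A_1 = 10\uparrow^3 10$ and $A_{n+1} = 10\uparrow^{A_n} 10$ for $n\ge 1$, where $\uparrow^k$ denotes Knuth's $k$-arrow operation. Then $A$ is total and computable in the sense that there exists a Turing machine which, given any integer $n\ge 1$ as input, outputs in finite time a symbolic expression for $A_n$.
   Context: Knuth's up-arrow operations $a\uparrow^k b$, for $a,b\in\mathbb{N}$ and integers $k\ge 1$, are defined recursively by: $a\uparrow^1 b = a^b$; $a\uparrow^k 1 = a$ for $k\ge 1$; $a\uparrow^k 0 = 1$ for $k\ge 2$; and $a\uparrow^k b = a\uparrow^{k-1}\big(a\uparrow^k (b-1)\big)$ for $k\ge 2$, $b\ge 2$. One also writes $\uparrow\uparrow\uparrow$ for $\uparrow^3$. A symbolic expression for $A_n$ is a finite string representing the nested hyperoperations that define $A_n$ (as opposed to its decimal expansion). For example, ''$10\uparrow\uparrow\uparrow 10$'' is a symbolic expression for $A_1$, and ''$10\uparrow^{10\uparrow^{10\uparrow\uparrow\uparrow 10}10}10$'' is a symbolic expression for $A_3$. In general, if $E_n$ is a symbolic expression for $A_n$, then the string ''$10\uparrow^{E_n}10$'' is a symbolic expression for $A_{n+1}$. *)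

(* Defs.v *)
From HB Require Import structures.
From mathcomp Require Import all_boot all_order all_algebra.

Set Implicit Arguments.
Unset Strict Implicit.
Unset Printing Implicit Defensive.

Local Open Scope nat_scope.

(** [knuth a k b c] is the graph of [a ↑^k b = c]: one constructor per defining
    equation.  Nothing is derivable for [k = 0], so that "has a value" is a
    genuine assertion for the functions defined from it. *)
Inductive knuth (a : nat) : nat -> nat -> nat -> Prop :=
| knuth_exp b : knuth a 1 b (a ^ b)
| knuth_one k : 1 <= k -> knuth a k 1 a
| knuth_zero k : 2 <= k -> knuth a k 0 1
| knuth_rec k b c d :
    2 <= k -> 2 <= b ->
    knuth a k b.-1 c -> knuth a k.-1 c d -> knuth a k b d.

(** [A_graph n m] is the graph of [n |-> A_n], a priori a partial and possibly
    multivalued function. *)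
Inductive A_graph : nat -> nat -> Prop :=
| A_graph1 m : knuth 10 3 10 m -> A_graph 1 m
| A_graphS n m p : 1 <= n -> A_graph n m -> knuth 10 m 10 p -> A_graph n.+1 p.

Inductive symbol :=
| Digit of 'I_10
| Arrow
| Caret
| LBrace
| RBrace.

Definition symbol_code (s : symbol) : 'I_10 + bool * bool :=
  match s with
  | Digit d => inl d
  | Arrow => inr (false, false)
  | Caret => inr (false, true)
  | LBrace => inr (true, false)
  | RBrace => inr (true, true)
  end.

Definition symbol_decode (c : 'I_10 + bool * bool) : symbol :=
  match c with
  | inl d => Digit d
  | inr (false, false) => Arrow
  | inr (false, true) => Caret
  | inr (true, false) => LBrace
  | inr (true, true) => RBrace
  end.

Lemma symbol_codeK : cancel symbol_code symbol_decode.
Proof. by case. Qed.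

HB.instance Definition _ := Finite.copy symbol (can_type symbol_codeK).

Fixpoint uint_digits (u : Decimal.uint) : seq symbol :=
  match u with
  | Decimal.Nil => [::]
  | Decimal.D0 v => Digit (@Ordinal 10 0 isT) :: uint_digits v
  | Decimal.D1 v => Digit (@Ordinal 10 1 isT) :: uint_digits v
  | Decimal.D2 v => Digit (@Ordinal 10 2 isT) :: uint_digits v
  | Decimal.D3 v => Digit (@Ordinal 10 3 isT) :: uint_digits v
  | Decimal.D4 v => Digit (@Ordinal 10 4 isT) :: uint_digits v
  | Decimal.D5 v => Digit (@Ordinal 10 5 isT) :: uint_digits v
  | Decimal.D6 v => Digit (@Ordinal 10 6 isT) :: uint_digits v
  | Decimal.D7 v => Digit (@Ordinal 10 7 isT) :: uint_digits v
  | Decimal.D8 v => Digit (@Ordinal 10 8 isT) :: uint_digits v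
  | Decimal.D9 v => Digit (@Ordinal 10 9 isT) :: uint_digits v
  end.

(** Usual decimal notation, most significant digit first, no leading zero. *)
Definition numeral (n : nat) : seq symbol := uint_digits (Nat.to_uint n).

(** The string "x↑…↑y", with [k] arrows. *)
Definition arrows_string (x k y : nat) : seq symbol :=
  numeral x ++ nseq k Arrow ++ numeral y.

(** The string "x↑^{E}y". *)
Definition power_string (x : nat) (E : seq symbol) (y : nat) : seq symbol :=
  numeral x ++ [:: Arrow; Caret; LBrace] ++ E ++ [:: RBrace] ++ numeral y.

(** [denotes E v]: the string [E], read as an expression in numerals and
    up-arrows, has the value [v]. *)
Inductive denotes : seq symbol -> nat -> Prop :=
| denotes_numeral x : denotes (numeral x) x
| denotes_arrows x k y v : knuth x k y v -> denotes (arrows_string x k y) v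
| denotes_power x E k y v :
    denotes E k -> knuth x k y v -> denotes (power_string x E y) v.

(** [A_string n E]: [E] spells out the nested hyperoperations in the definition
    of [A_n], with no subexpression replaced by its decimal expansion. *)
Inductive A_string : nat -> seq symbol -> Prop :=
| A_string1 : A_string 1 (arrows_string 10 3 10)
| A_stringS n E : A_string n E -> A_string n.+1 (power_string 10 E 10).

Definition symbolic_expression (n : nat) (E : seq symbol) : Prop :=
  A_string n E /\ exists2 v, A_graph n v & denotes E v.

Inductive move := MoveLeft | Stay | MoveRight.

(** Deterministic Turing machines with one two-way infinite tape.  A tape symbol
    is the blank [None], a symbol of the input/output alphabet [S], or one of
    finitely many auxiliary symbols. *)
Record turing_machine (S : finType) := TuringMachine {
  tm_state : finType;
  tm_aux : finType;
  tm_start : tm_state;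
  tm_halting : pred tm_state;
  tm_trans :
    tm_state -> option (S + tm_aux) -> tm_state * option (S + tm_aux) * move
}.

Section Run.
Variables (S : finType) (M : turing_machine S).

Definition tm_symbol : Type := option (S + tm_aux M).

Record tm_config := TMConfig {
  cfg_state : tm_state M;
  cfg_tape : int -> tm_symbol;
  cfg_head : int
}.

Definition tape_of (w : seq S) (i : int) : tm_symbol :=
  match i with
  | Posz k => nth None [seq Some (inl a) | a <- w] k
  | Negz _ => None
  end.

Definition tm_init (w : seq S) : tm_config :=
  TMConfig (tm_start M) (tape_of w) 0%R.

Definition move_head (d : move) (h : int) : int :=
  match d with
  | MoveLeft => (h - 1)%R
  | Stay => h
  | MoveRight => (h + 1)%R
  end.

Definition tm_step (c : tm_config) : tm_config :=
  let: TMConfig q t h := c in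
  if tm_halting q then c
  else
    let: (q', a, d) := tm_trans q (t h) in
    TMConfig q' (fun i => if i == h then a else t i) (move_head d h).

(** Started on the first symbol of [w], [M] halts after finitely many steps with
    [v] as the entire content of its tape, at any position. *)
Definition tm_outputs (w v : seq S) : Prop :=
  exists k : nat,
    let c := iter k tm_step (tm_init w) in
    tm_halting (cfg_state c) /\
    exists p : int, forall i : int, cfg_tape c i = tape_of v (i - p)%R.

End Run.

(* Main.v *)
Require Import Defs.
From HB Require Import structures.
From mathcomp Require Import all_boot all_order all_algebra.
From mathcomp Require Import zify.
From Stdlib Require DecimalNat.

Set Implicit Arguments.
Unset Strict Implicit.
Unset Printing Implicit Defensive.

Import GRing.Theory.
Local Open Scope nat_scope.

(** The arrow recursion is lexicographic in the number [k] of arrows and the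
    right argument [b], and its clauses overlap only where they agree, so
    [a ↑^k b] exists and is unique for every [k >= 1].  Since the values are
    positive when [a] is, [A_n] may serve as a number of arrows in turn, which
    makes [A] total and single-valued ([A_total], [A_unique]).

    The value of [A_n] is never computed by the machine: it only has to spell
    the string in which the core 10↑↑↑10 is wrapped [n - 1] times between the
    opening 10↑^{ and the closing }10.  The obstacle is that the decimal input
    must stay on one side of the growing string, which grows on both sides.
    The wrapping is therefore done in two stages.  In the first one the input
    [n] is used as a counter, standing to the left of the output and separated
    from it by a blank.  Each decrement appends something at the right end: the
    core the first time, and then closings whose brace is marked
    ([counting_stage]).  When the counter underflows it is erased, so that the
    left side becomes free, and the [n - 1] marked braces are now a unary copy
    of the number of openings still missing.  In the second stage each marked
    brace is unmarked, from left to right, and an opening is written at the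
    left end; every such round turns the unmarked part [E] into 10↑^{E}10
    ([wrapping_stage]).

    Runs are analysed on zippers, that is, pairs of lists on either side of the
    head, and transferred to tapes indexed by integers by [represents_step]. *)

(** * Knuth arrows and the sequence A *)

Lemma knuth_total a k b : 0 < a -> 0 < k -> exists2 c, 0 < c & knuth a k b c.
Proof.
move=> a_gt0; elim: k b => // -[|k] IHk b _.
  by exists (a ^ b); [rewrite expn_gt0 a_gt0 | exact: knuth_exp].
elim: b => [|[|b] [c _ abc]]; first by exists 1 => //; exact: knuth_zero.
  by exists a => //; exact: knuth_one.
have [d d_gt0 acd] := IHk c isT.
by exists d => //; apply: (@knuth_rec _ _ _ c).
Qed.

Lemma knuth_unique a k b c c' : knuth a k b c -> knuth a k b c' -> c = c'.
Proof.
move=> abc; elim: abc c' => {k b c}.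
- move=> b c' abc'; inversion abc'; subst; by rewrite ?expn1.
- move=> k k_gt0 c' abc'; inversion abc'; subst; by rewrite ?expn1.
- by move=> k k_gt1 c' abc'; inversion abc'; subst.
- move=> k b c d k_gt1 b_gt1 _ IHc _ IHd c' abc'.
  inversion abc' as [| | |k' b' e d' _ _ abe aed]; subst => //.
  by apply: IHd; rewrite (IHc _ abe).
Qed.

Lemma A_total n : 0 < n -> exists2 m, 0 < m & A_graph n m.
Proof.
elim: n => // -[|n] IHn _.
  by have [m ? ?] := @knuth_total 10 3 10 isT isT; exists m => //; left.
have [m m_gt0 Am] := IHn isT.
have [p p_gt0 Ap] := @knuth_total 10 m 10 isT m_gt0.
by exists p => //; apply: A_graphS Am Ap.
Qed.

Lemma A_unique n m m' : A_graph n m -> A_graph n m' -> m = m'.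
Proof.
move=> Am; elim: Am m' => {n m} [m Km|n m p n_gt0 _ IHm Kp] m' Am'.
  by inversion Am' as [? Km'|]; subst => //; apply: knuth_unique Km Km'.
inversion Am' as [|n1 m1 p1 _ Am1 Kp1]; subst => //.
by move: Kp1; rewrite -(IHm _ Am1); apply: knuth_unique.
Qed.

Lemma A_string_gt0 n E : A_string n E -> 0 < n.
Proof. by case. Qed.

(** The value of [A_n] enters [A_(n+1)] only as a number of arrows, hence the string has
    that value as soon as the graph does. *)
Lemma A_string_denotes n E v : A_string n E -> A_graph n v -> denotes E v.
Proof.
move=> AE; elim: AE v => {n E} [|n E AE IHE] v Av.
  inversion Av as [? Kv|]; subst => //; exact: denotes_arrows.
inversion Av as [|n1 m p _ Am Kp]; subst; first by inversion AE.
by apply: denotes_power Kp; apply: IHE.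
Qed.

Lemma A_string_symbolic n E : A_string n E -> symbolic_expression n E.
Proof.
move=> AE; have [v _ Av] := A_total (A_string_gt0 AE).
by split => //; exists v => //; apply: A_string_denotes Av.
Qed.

(** * Decimal counters *)

(** The least significant digit comes first: this is the order in which a head
    moving left meets the digits. *)
Definition counter_value (ds : seq 'I_10) : nat :=
  foldr (fun (d : 'I_10) v => d + 10 * v) 0 ds.

(** Horner's scheme: [a] is the value of the digits already read. *)
Lemma uint_digits_value u a :
  exists2 ds : seq 'I_10, uint_digits u = map Digit ds
    & Nat.of_uint_acc u a = foldl (fun v (d : 'I_10) => d + 10 * v) a ds.
Proof.
have step (d : 'I_10) v b :
    (exists2 ds : seq 'I_10, uint_digits v = map Digit ds &
       Nat.of_uint_acc v (d + 10 * b)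
       = foldl (fun v (d : 'I_10) => d + 10 * v) (d + 10 * b) ds) ->
    exists2 ds : seq 'I_10, Digit d :: uint_digits v = map Digit ds &
       Nat.of_uint_acc v (d + 10 * b)
       = foldl (fun v (d : 'I_10) => d + 10 * v) b ds.
  by move=> [ds -> ->]; exists (d :: ds).
elim: u a => [|u IH|u IH|u IH|u IH|u IH|u IH|u IH|u IH|u IH|u IH] a;
  first (by exists [::]);
  rewrite [Nat.of_uint_acc _ _]/= PeanoNat.Nat.tail_mul_spec;
  exact: step (IH _).
Qed.

Lemma numeral_counter n :
  exists2 ds, numeral n = map Digit (rev ds) & counter_value ds = n.
Proof.
have [ds Dds val_ds] := uint_digits_value (Nat.to_uint n) 0.
exists (rev ds); first by rewrite revK.
rewrite /counter_value -[LHS]foldl_rev revK -val_ds; exact: DecimalNat.Unsigned.of_to.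
Qed.

(** * Runs on zippers *)

Section Zippers.
Variable M : turing_machine symbol.

Notation cell := (tm_symbol M).

(** The cells left of the head, nearest first, then the scanned cell and those
    right of it; both lists are continued by blanks. *)
Definition zipper : Type := tm_state M * seq cell * seq cell.

(** The head stands on the nearest cell of [l]. *)
Definition on_left (q : tm_state M) (l r : seq cell) : zipper :=
  (q, behead l, head None l :: r).

Definition zstep (z : zipper) : zipper :=
  let: (q, l, r) := z in
  if tm_halting q then z else
  let: (q', a, d) := tm_trans q (head None r) in
  match d with
  | MoveLeft => on_left q' l (a :: behead r)
  | Stay => (q', l, a :: behead r)
  | MoveRight => (q', a :: l, behead r)
  end.

Definition reaches (z z' : zipper) : Prop := exists k, iter k zstep z = z'.

Lemma reaches_refl z : reaches z z.
Proof. by exists 0. Qed.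

Lemma reaches_trans z2 z1 z3 : reaches z1 z2 -> reaches z2 z3 -> reaches z1 z3.
Proof. by move=> [k <-] [j <-]; exists (j + k); rewrite iterD. Qed.

Lemma reaches_step z1 z2 : reaches (zstep z1) z2 -> reaches z1 z2.
Proof. by apply: reaches_trans; exists 1. Qed.

Lemma scan_right (T : Type) (f : T -> cell) q s l r :
    ~~ tm_halting q -> (forall x, tm_trans q (f x) = (q, f x, MoveRight)) ->
  reaches (q, l, map f s ++ r) (q, rev (map f s) ++ l, r).
Proof.
move=> /negbTE q_run q_trans; elim: s l => [|x s IHs] l; first exact: reaches_refl.
apply: reaches_step; rewrite /= q_run q_trans rev_cons cat_rcons; exact: IHs.
Qed.

Lemma scan_left (T : Type) (f : T -> cell) q s l r :
    ~~ tm_halting q -> (forall x, tm_trans q (f x) = (q, f x, MoveLeft)) ->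
  reaches (on_left q (map f s ++ l) r) (on_left q l (rev (map f s) ++ r)).
Proof.
move=> /negbTE q_run q_trans; elim: s r => [|x s IHs] r; first exact: reaches_refl.
apply: reaches_step; rewrite /= q_run q_trans rev_cons cat_rcons; exact: IHs.
Qed.

(** Coordinates are relative to the head, so that a zipper has no position of
    its own. *)
Definition ztape (l r : seq cell) (i : int) : cell :=
  match i with
  | Posz k => nth None r k
  | Negz k => nth None l k
  end.

Definition represents (c : tm_config M) (z : zipper) : Prop :=
  let: (q, l, r) := z in
  cfg_state c = q /\
  forall i, cfg_tape c (cfg_head c + i)%R = ztape l r i.

(** A move of the head shifts relative coordinates by one, which transfers one
    cell from one list to the other; this makes the case analysis on [i]. *)
Lemma represents_step c z :
  represents c z -> represents (tm_step c) (zstep z).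
Proof.
case: c => q t h; case: z => [[q1 l] r] [/= <- tape_eq].
case: ifP => // _; have := tape_eq 0%R; rewrite addr0 /= nth0 => ->.
case: (tm_trans _ _) => [[q' a] d].
have shift i j : (h + j = h + i)%R -> j != 0%R ->
    (if (h + i)%R == h then a else t (h + i)%R) = ztape l r j.
  move=> <- j_neq0; rewrite -tape_eq ifN //.
  by rewrite -subr_eq0 addrAC subrr add0r.
case: d; split=> //= i; rewrite -?addrA.
- case: i => [[|[|k]]|k] /=.
  + rewrite -nth0 (shift _ (Negz 0)) //; lia.
  + by rewrite ifT //; apply/eqP; lia.
  + rewrite (shift _ (Posz k.+1)) ?nth_behead //; lia.
  + rewrite nth_behead (shift _ (Negz k.+1)) //; lia.
- case: i => [[|k]|k] /=.
  + by rewrite addr0 eqxx.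
  + by rewrite nth_behead (shift _ (Posz k.+1)).
  + by rewrite (shift _ (Negz k)).
- case: i => [k|[|k]] /=.
  + rewrite nth_behead (shift _ (Posz k.+1)) //; lia.
  + by rewrite ifT //; apply/eqP; lia.
  + rewrite (shift _ (Negz k)) //; lia.
Qed.

Lemma represents_iter k c z :
  represents c z -> represents (iter k (@tm_step _ M) c) (iter k zstep z).
Proof. by move=> cz; elim: k => //= k; apply: represents_step. Qed.

Definition plain (a : symbol) : cell := Some (inl a).

Lemma represents_init w :
  represents (tm_init M w) (tm_start M, [::], map plain w).
Proof. by split=> // -[k|k] /=; rewrite ?nth_nil. Qed.

(** Erasing the counter leaves explicit blanks around the output; they do not
    show on the tape. *)
Lemma reaches_outputs w v q m r :
    tm_halting q -> (forall k, nth None r k = None) ->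
    reaches (tm_start M, [::], map plain w)
            (q, rev (map plain v) ++ nseq m None, r) ->
  tm_outputs M w v.
Proof.
move=> q_halt r_blank [k run]; exists k.
have := represents_iter k (represents_init w); rewrite run.
set c := iter k _ _ => -[/= c_state tape_eq]; split; first by rewrite c_state.
exists (cfg_head c - (size v)%:Z)%R => i.
rewrite -[i in LHS](subrK (cfg_head c)) addrC tape_eq.
have -> : (i - (cfg_head c - (size v)%:Z) = (i - cfg_head c) + (size v)%:Z)%R.
  by lia.
have beyond j : size v <= j -> nth None (map plain v) j = None.
  by move=> le_v_j; rewrite nth_default ?size_map.
case: (i - cfg_head c)%R => j; first by rewrite /= r_blank beyond ?leq_addl.
rewrite /= nth_cat size_rev size_map nth_nseq if_same.
case: ltnP => [lt_j_v | le_v_j].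
  rewrite nth_rev ?size_map //.
  by have -> : (Negz j + (size v)%:Z = (size v - j.+1)%N)%R by lia.
have [k' ->] : exists k', (Negz j + (size v)%:Z)%R = Negz k' by exists (j - size v); lia.
by [].
Qed.

End Zippers.

(** * The machine *)

Inductive state :=
| ToUnits | Decrement | ToSeparator | Append | ToEnd | WriteRight of 'I_7 | Back
| Erase | FindMark | ToFront | WriteLeft of 'I_5 | Halt.

Definition state_code (q : state) : 'I_7 + 'I_5 + 'I_10 :=
  match q with
  | WriteRight i => inl (inl i)
  | WriteLeft i => inl (inr i)
  | ToUnits => inr (@Ordinal 10 0 isT)
  | Decrement => inr (@Ordinal 10 1 isT)
  | ToSeparator => inr (@Ordinal 10 2 isT)
  | Append => inr (@Ordinal 10 3 isT)
  | ToEnd => inr (@Ordinal 10 4 isT)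
  | Back => inr (@Ordinal 10 5 isT)
  | Erase => inr (@Ordinal 10 6 isT)
  | FindMark => inr (@Ordinal 10 7 isT)
  | ToFront => inr (@Ordinal 10 8 isT)
  | Halt => inr (@Ordinal 10 9 isT)
  end.

Definition state_decode (c : 'I_7 + 'I_5 + 'I_10) : state :=
  match c with
  | inl (inl i) => WriteRight i
  | inl (inr i) => WriteLeft i
  | inr i => nth Halt [:: ToUnits; Decrement; ToSeparator; Append; ToEnd; Back;
                          Erase; FindMark; ToFront] i
  end.

Lemma state_codeK : cancel state_code state_decode.
Proof. by case. Qed.

HB.instance Definition _ := Finite.copy state (can_type state_codeK).

Notation cell := (option (symbol + unit)).
Notation digit d := (Some (inl (Digit d)) : cell).
Notation mark := (Some (inr tt) : cell).

Definition core : seq symbol := arrows_string 10 3 10.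
Definition opening : seq symbol := numeral 10 ++ [:: Arrow; Caret; LBrace].

Definition trans (q : state) (x : cell) : state * cell * move :=
  match q, x with
  | ToUnits, None => (Decrement, None, MoveLeft)
  | ToUnits, _ => (ToUnits, x, MoveRight)
  (* [ord_pred] is cyclic: a zero becomes a nine, and then a unit has to be
     borrowed from the next digit. *)
  | Decrement, Some (inl (Digit d)) =>
      if d == ord0 then (Decrement, digit (ord_pred d), MoveLeft)
      else (ToSeparator, digit (ord_pred d), MoveRight)
  | Decrement, _ => (Erase, None, MoveRight)
  | ToSeparator, None => (Append, None, MoveRight)
  | ToSeparator, _ => (ToSeparator, x, MoveRight)
  | Append, None => (WriteRight ord0, None, Stay)
  | Append, _ => (ToEnd, x, Stay)
  (* The 10 that closes the core also serves after the mark. *)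
  | ToEnd, None => (WriteRight (@Ordinal 7 5 isT), mark, MoveRight)
  | ToEnd, _ => (ToEnd, x, MoveRight)
  | WriteRight i, _ =>
      let a := Some (inl (nth Arrow core i)) in
      if i == ord_max then (Back, a, Stay)
      else (WriteRight (ordS i), a, MoveRight)
  | Back, None => (Decrement, None, MoveLeft)
  | Back, _ => (Back, x, MoveLeft)
  | Erase, None => (FindMark, None, MoveRight)
  | Erase, _ => (Erase, None, MoveRight)
  | FindMark, None => (Halt, None, Stay)
  | FindMark, Some (inr _) => (ToFront, Some (inl RBrace), MoveLeft)
  | FindMark, _ => (FindMark, x, MoveRight)
  | ToFront, None => (WriteLeft ord_max, None, Stay)
  | ToFront, _ => (ToFront, x, MoveLeft)
  | WriteLeft i, _ =>
      let a := Some (inl (nth Arrow opening i)) in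
      if i == ord0 then (FindMark, a, Stay)
      else (WriteLeft (ord_pred i), a, MoveLeft)
  | Halt, _ => (Halt, x, Stay)
  end.

Definition wrapper : turing_machine symbol :=
  @TuringMachine symbol state unit ToUnits (pred1 Halt) trans.

Definition marked_closing : seq (symbol + unit) :=
  inr tt :: map inl (numeral 10).

(** What the counting stage has written after [k + 1] decrements. *)
Definition marked_output (k : nat) : seq (symbol + unit) :=
  map inl core ++ flatten (nseq k marked_closing).

Notation digits ds := [seq digit d | d <- ds].
Notation config q l r := ((q, l, r) : zipper wrapper).
Notation at_left q l r := (@on_left wrapper q l r).

(** * Counting *)

(** A borrow turns the low-order zeros into nines; they end up right of the
    head as [es]. *)
Lemma decrement_pos ds W : 0 < counter_value ds ->
  exists2 ds', (counter_value ds').+1 = counter_value ds &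
    forall es, reaches (at_left Decrement (digits ds) (digits es ++ None :: W))
                       (config Append (None :: digits (catrev es ds')) W).
Proof.
elim: ds => // d ds IHds.
have [d0 | d_neq0] := eqVneq d ord0.
  rewrite d0 /= add0n muln_gt0 => /IHds[ds' val_ds' run].
  exists (ord_pred ord0 :: ds') => [|es]; first by rewrite -val_ds' /=; lia.
  by apply: reaches_step; apply: (run (ord_pred ord0 :: es)).
move=> _; exists (ord_pred d :: ds) => [|es].
  by case: d d_neq0 => [[|d] lt_d] //= _; lia.
apply: reaches_step; rewrite /zstep /= (negbTE d_neq0).
apply: reaches_trans.
  by apply: (scan_right (M := wrapper) (f := fun d => digit d)).
apply: reaches_step; rewrite catrevE map_cat -map_rev; exact: reaches_refl.
Qed.

Lemma erase_run m es W :
  reaches (config Erase (nseq m None) (digits es ++ None :: W))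
          (config FindMark (nseq (m + size es).+1 None) W).
Proof.
elim: es m => [|d es IHes] m; apply: reaches_step.
  by rewrite addn0; apply: reaches_refl.
by rewrite [size _]/= addnS -addSn; apply: (IHes m.+1).
Qed.

(** On underflow the counter is a block of nines, and the head is on the blank
    to its left. *)
Lemma decrement_zero ds es W : counter_value ds = 0 ->
  exists m, reaches (at_left Decrement (digits ds) (digits es ++ None :: W))
                    (config FindMark (nseq m None) W).
Proof.
elim: ds es => [|d ds IHds] es /=.
  by move=> _; eexists; apply: reaches_step; apply: (erase_run 1).
move/eqP; rewrite addn_eq0 muln_eq0 /= => /andP[/eqP d0 /eqP ds0].
have {d0}-> : d = ord0 by apply: val_inj.
have [m run] := IHds (ord_pred ord0 :: es) ds0.
by exists m; apply: reaches_step.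
Qed.

Lemma append_core l :
  reaches (config Append l [::])
          (at_left Back (rev (map Some (marked_output 0)) ++ l) [::]).
Proof. by exists 8. Qed.

Lemma marked_outputS k : marked_output k.+1 = marked_output k ++ marked_closing.
Proof.
rewrite /marked_output -catA; congr cat.
by elim: k => //= k <-.
Qed.

Lemma append_closing k l :
  reaches (config Append l (map Some (marked_output k)))
          (at_left Back (rev (map Some (marked_output k.+1)) ++ l) [::]).
Proof.
apply: reaches_step.
have -> : zstep (config Append l (map Some (marked_output k)))
  = config ToEnd l (map Some (marked_output k) ++ [::]) by rewrite cats0.
rewrite marked_outputS map_cat rev_cat -catA.
apply: reaches_trans; first by apply: (scan_right (M := wrapper)).
by exists 3.
Qed.

Lemma back_run s l :
  reaches (at_left Back (rev (map Some s) ++ None :: l) [::])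
          (at_left Decrement l (None :: map Some s)).
Proof.
rewrite -map_rev; apply: reaches_trans.
  by apply: (scan_left (M := wrapper) (f := Some)).
by rewrite -map_rev revK cats0; exists 1.
Qed.

(** The blank that separates the counter from the output stays in place, so each
    round starts from the same kind of configuration; the value of the counter
    turns into a number of marked closings. *)
Lemma counting_stage k ds :
  exists m,
    reaches (at_left Decrement (digits ds) (None :: map Some (marked_output k)))
            (config FindMark (nseq m None)
                    (map Some (marked_output (k + counter_value ds)))).
Proof.
move Dv: (counter_value ds) => v; elim: v k ds Dv => [|v IHv] k ds Dv.
  by rewrite addn0; apply: (decrement_zero [::]).
have [|ds' val_ds' run] := @decrement_pos ds (map Some (marked_output k)).
  by rewrite Dv.
have [|m run'] := IHv k.+1 ds'; first by apply: succn_inj; rewrite val_ds'.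
exists m; rewrite addnS -addSn; apply: reaches_trans run'.
apply: reaches_trans (run [::]) _.
exact: reaches_trans (append_closing _ _) (back_run _ _).
Qed.

(** The input is positive, so the first decrement succeeds; it finds nothing
    right of the separator and writes the core, which leaves [n - 1] for the
    closings. *)
Lemma start_run n : 0 < n ->
  exists m, reaches (config ToUnits [::] (map (plain wrapper) (numeral n)))
                    (config FindMark (nseq m None)
                            (map Some (marked_output n.-1))).
Proof.
have [ds -> <-] := numeral_counter n => ds_gt0.
have [ds' val_ds' run] := @decrement_pos ds [::] ds_gt0.
have [m run'] := counting_stage 0 ds'.
exists m; rewrite -val_ds'; apply: reaches_trans run'.
apply: reaches_trans (back_run _ _); apply: reaches_trans (append_core _).
apply: reaches_trans (run [::]).
rewrite -map_comp -[map _ _]cats0; apply: reaches_trans.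
  by apply: (scan_right (M := wrapper) (f := fun d => digit d)).
by rewrite -map_rev revK cats0; exists 1.
Qed.

(** * Wrapping *)

(** The cells left of the output are blanks left behind by the counter, or
    untouched ones once those are used up. *)
Lemma write_opening m r :
  exists m', reaches (at_left ToFront (nseq m None) r)
    (config FindMark (nseq m' None) (map (plain wrapper) opening ++ r)).
Proof.
exists (m - 5).
by exists 6; case: m => [|[|[|[|[|m]]]]]; rewrite ?subSS ?subn0.
Qed.

(** [E] is what has been unmarked so far; every marked closing costs one round
    and adds one level to it. *)
Lemma wrapping_stage n E k m : A_string n E ->
  exists E' m', A_string (n + k) E' /\
    reaches (config FindMark (nseq m None)
               (map (plain wrapper) E ++
                map Some (flatten (nseq k marked_closing))))
            (config Halt (rev (map (plain wrapper) E') ++ nseq m' None)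
                    [:: None]).
Proof.
elim: k n E m => [|k IHk] n E m AE.
  exists E, m; rewrite addn0; split=> //.
  apply: reaches_trans; first by apply: (scan_right (M := wrapper)).
  by exists 1.
set rest := map Some _.
have [m1 write_run] := write_opening m (map (plain wrapper) E ++
  Some (inl RBrace) :: behead rest).
have [E' [m' [AE' wrap_run]]] := IHk _ _ m1 (A_stringS AE).
exists E', m'; rewrite addnS -addSn; split=> //.
apply: reaches_trans wrap_run.
have -> : map (plain wrapper) (power_string 10 E 10)
    ++ map Some (flatten (nseq k marked_closing))
  = map (plain wrapper) opening ++ map (plain wrapper) E
    ++ Some (inl RBrace) :: behead rest.
  by rewrite /power_string /opening !map_cat -!catA.
apply: reaches_trans write_run.
apply: reaches_trans; first by apply: (scan_right (M := wrapper)).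
apply: reaches_step; rewrite -map_rev.
apply: reaches_trans; first by apply: (scan_left (M := wrapper)).
rewrite -map_rev revK; exact: reaches_refl.
Qed.

Theorem theorem5p1 :
  (forall n : nat, (1 <= n)%N -> exists! m : nat, A_graph n m) /\
  (exists M : turing_machine symbol,
     forall n : nat, (1 <= n)%N ->
       exists E : seq symbol,
         symbolic_expression n E /\ tm_outputs M (numeral n) E).
Proof.
split=> [n n_gt0 | ].
  have [m _ Am] := A_total n_gt0.
  by exists m; split=> // m'; apply: A_unique.
exists wrapper => n n_gt0.
have [m run] := start_run n_gt0.
have [E [m' [AE run']]] := wrapping_stage n.-1 m A_string1.
rewrite add1n prednK // in AE.
exists E; split; first exact: A_string_symbolic.
apply: (@reaches_outputs wrapper _ _ Halt m' [:: None]) => //.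
  by case=> [|[]].
by apply: reaches_trans run _; rewrite map_cat -map_comp.
Qed.
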